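(* For every $\epsilon>0$ there is a constant $C_\epsilon>0$, depending only on $\epsilon$, such that the following holds. Let $p$ be a prime, let $N$ be an integer with $1\le N\le p-1$, let $r$ be a positive integer, let $a,b,b_1,\dots,b_r$ be integers, not all divisible by $p$, with $\gcd(b,p)=1$, and let $g_1,\dots,g_r$ be primitive roots modulo $p$. Then $$\left|\frac{1}{\varphi(p-1)}\sum_{g}\ \sum_{x=1}^{N} e_p\big(ax+bg^x+b_1g_1^x+\cdots+b_rg_r^x\big)\right|\le C_\epsilon\, p^{\frac{23}{24}+\epsilon},$$ where the outer sum runs over all primitive roots $g$ modulo $p$ (one representative of each residue class modulo $p$ that is a primitive root).
   Context: Notation: $e_p(\alpha):=\exp(2\pi i\alpha/p)$, and $\varphi$ is Euler's totient function, so $\varphi(p-1)$ is the number of primitive roots modulo $p$. In the exponents $x$ is an ordinary integer in $\{1,\dots,N\}$. *)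

(* Defs.v *)
From HB Require Import structures.
From mathcomp Require Import all_boot all_order all_algebra.
From mathcomp Require Import all_classical all_reals all_analysis.
From mathcomp Require Export complex.
Set Implicit Arguments.
Unset Strict Implicit.
Unset Printing Implicit Defensive.
Import Order.TTheory GRing.Theory Num.Theory.
Local Open Scope ring_scope.
Local Open Scope complex_scope.

(* The complex exponential, via exp (u + i v) = exp u * (cos v + i sin v). *)
Definition cexp (R : realType) (z : R[i]) : R[i] :=
  (expR (complex.Re z))%:C * (cos (complex.Im z) +i* sin (complex.Im z)).

Definition e_ (R : realType) (p : nat) (alpha : int) : R[i] :=
  cexp ((2 * pi)%:C * 'i * alpha%:~R / p%:R).

(* For p prime, 'F_p is Z/pZ and its nonzero elements form a group of order
   p - 1, so a primitive root modulo p is an element of order p - 1 there. *)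
Definition primitive_root_mod (p : nat) (g : int) : bool :=
  (p.-1).-primitive_root (g%:~R : 'F_p).

(* The primitive roots are represented by integers in {0, ..., p - 1}. *)
Definition primitive_root_avg (R : realType) (p : nat) (F : int -> R[i]) :
    R[i] :=
  (totient p.-1)%:R^-1 *
    \sum_(g < p | primitive_root_mod p (g : nat)%:Z) F (g : nat)%:Z.

(* Main.v *)
(** Only the terms with the averaged base g need cancellation: every other
    factor has modulus 1, so by the triangle inequality it suffices to bound
    the sum over x of |sum_g e_p(b g^x)|.  Put n = p - 1.  The primitive roots
    are the units lying in none of the subgroups {z | z^(n/q) = 1}, q a prime
    factor of n, so inclusion-exclusion reduces the sum over g to at most
    2^omega(n) sums over subgroups G of the unit group.  Each of these is at
    most gcd(x, n) sqrt(p): c |-> |sum_(z in G) e_p(c z^x)|^2 is constant on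
    the orbit {b w^x | w in G}, and its total over all c is computed by
    orthogonality.  As sum_x gcd(x, n) <= n tau(n) and n <= 2^omega(n) phi(n),
    the average is at most tau(n)^3 sqrt(p) <= C p^(3/4), which is stronger
    than the exponent claimed. *)
Require Import Defs.
From mathcomp Require Import all_boot all_order all_algebra.
From mathcomp Require Import all_classical all_reals all_analysis.
From mathcomp Require Import all_fingroup all_solvable.
From mathcomp Require Import zify ring lra.
Import Order.TTheory GRing.Theory Num.Theory.
Local Open Scope nat_scope.

(** * Divisor counts, the totient and sums of gcds *)

Lemma size_divisors n :
  0 < n -> size (divisors n) = \prod_(q <- primes n) (logn q n).+1.
Proof.
move=> n_gt0; rewrite /divisors prime_decompE.
elim: (primes n) => [|q s IHs] /=; first by rewrite big_nil.
rewrite big_cons -IHs; move: (foldr _ _ _) => ds /=.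
elim: (logn q n) => [|e IHe] /=; first by rewrite mul1n.
by rewrite size_merge size_cat size_map IHe addnC -mulSn.
Qed.

Lemma prod_const_seq (T : eqType) (s : seq T) k :
  \prod_(i <- s) k = k ^ size s.
Proof. by rewrite big_const_seq count_predT iter_muln_1. Qed.

Lemma exp2_size_primes n : 0 < n -> 2 ^ size (primes n) <= size (divisors n).
Proof.
move=> n_gt0; rewrite size_divisors // -prod_const_seq.
rewrite big_seq [leqRHS]big_seq.
by apply: leq_prod => q; rewrite -logn_gt0.
Qed.

(** Prime by prime, this is [q <= 2 * (q - 1)]. *)
Lemma leq_totient n : 0 < n -> n <= 2 ^ size (primes n) * totient n.
Proof.
move=> n_gt0; rewrite totientE // {1}[n]prod_prime_decomp // prime_decompE.
rewrite big_map -prod_const_seq -big_split /= [leqLHS]big_seq [leqRHS]big_seq.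
apply: leq_prod => q q_n; have := q_n; rewrite -logn_gt0 => /prednK <-.
move: q_n; rewrite mem_primes => /and3P[/prime_gt1 q_gt1 _ _].
rewrite expnS mulnA leq_mul2r; apply/orP; right.
rewrite mul2n -addnn -[leqLHS](ltn_predK q_gt1) -addn1 leq_add2l.
by rewrite -ltnS (ltn_predK q_gt1).
Qed.

(** With [k = e %/ K], one has [e + 1 <= K * (k + 1) <= K * 2 ^ k]; then take [K]-th powers. *)
Lemma expSn_leq K e : 0 < K -> e.+1 ^ K <= K ^ K * 2 ^ e.
Proof.
move=> K_gt0.
have leK : e.+1 <= K * 2 ^ (e %/ K).
  apply: leq_trans (_ : K * (e %/ K).+1 <= _).
    by rewrite mulnC ltn_ceil.
  by rewrite leq_mul2l ltn_expl ?orbT.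
apply: leq_trans (_ : (K * 2 ^ (e %/ K)) ^ K <= _); first by rewrite leq_exp2r.
by rewrite expnMn -expnM leq_mul2l leq_exp2l // leq_trunc_div orbT.
Qed.

(** The divisor bound with an explicit constant. For [q >= 2 ^ K] the local factor obeys
    [(e + 1) ^ K <= 2 ^ (e * K) <= q ^ e]. Each smaller prime costs [K ^ K] by [expSn_leq], and
    there are at most [2 ^ K] of them. *)
Lemma size_divisors_exp K n :
  0 < K -> 0 < n -> size (divisors n) ^ K <= (K ^ K) ^ (2 ^ K) * n.
Proof.
move=> K_gt0 n_gt0; pose M q := if q < 2 ^ K then K ^ K else 1.
have KK_gt0 : 0 < K ^ K by rewrite expn_gt0 K_gt0.
apply: leq_trans (_ : (\prod_(q <- primes n) M q) * n <= _).
  rewrite {3}[n]prod_prime_decomp // prime_decompE big_map -big_split /=.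
  rewrite size_divisors //.
  rewrite (big_morph (expn^~ K) (fun a b => expnMn a b K) (exp1n K)).
  rewrite [leqLHS]big_seq [leqRHS]big_seq.
  apply: leq_prod => q; rewrite mem_primes => /and3P[/prime_gt1 q_gt1 _ _].
  rewrite /M; case: ltnP => [_|leq].
    apply: leq_trans (expSn_leq _ _ K_gt0) _.
    by rewrite leq_mul2l; case: (logn q n) => [|e]; rewrite ?expn0 ?leq_exp2r ?q_gt1 ?orbT.
  rewrite mul1n; apply: leq_trans (_ : (2 ^ logn q n) ^ K <= _).
    by rewrite leq_exp2r // ltn_expl.
  rewrite -expnM mulnC expnM.
  by case: (logn q n) => // e; rewrite leq_exp2r.
rewrite leq_mul2r; apply/orP; right.
rewrite -big_mkcond /= -big_filter prod_const_seq leq_pexp2l //.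
rewrite -[leqRHS](size_iota 0) uniq_leq_size ?filter_uniq ?primes_uniq // => q.
by rewrite mem_filter mem_iota => /andP[].
Qed.

(** The gcd is one of the common divisors of [x] and [n], so it is at most their sum. After
    exchanging sums, each [d] dividing [n] contributes [d * (n %/ d) = n]. *)
Lemma sum_gcdn n :
  \sum_(1 <= x < n.+1) gcdn x n <= n * size (divisors n).
Proof.
have [->|n_gt0] := posnP n; first by rewrite big_geq.
rewrite -sum1_size big_distrr /=.
apply: leq_trans
  (_ : \sum_(1 <= x < n.+1) \sum_(d <- divisors n) d * (d %| x) <= _).
  apply: leq_sum => x _.
  rewrite (big_rem (gcdn x n)) /=; last by rewrite -dvdn_divisors // dvdn_gcdr.
  by rewrite dvdn_gcdl muln1 leq_addr.
rewrite exchange_big /= big_seq [leqRHS]big_seq leq_sum // => d.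
rewrite -dvdn_divisors // => dn.
by rewrite -big_distrr /= -divn_count_dvd mulnC divnK // muln1.
Qed.

Local Open Scope ring_scope.

(** * Sums of an additive character over subgroups of the unit group *)

Section AdditiveCharacter.
Variables (F : finFieldType) (C : numClosedFieldType) (psi : F -> C).
Hypothesis psiD : forall u v, psi (u + v) = psi u * psi v.
Hypothesis norm_psi : forall u, `|psi u| = 1.
Hypothesis psi_nontriv : exists u, psi u != 1.

Lemma psi_0 : psi 0 = 1.
Proof.
apply: (mulfI (x := psi 0)); first by rewrite -normr_eq0 norm_psi oner_eq0.
by rewrite -psiD addr0 mulr1.
Qed.

Lemma psi_conj u : (psi u)^* = psi (- u).
Proof.
apply: (mulfI (x := psi u)); first by rewrite -normr_eq0 norm_psi oner_eq0.
by rewrite -normCK norm_psi expr1n -psiD subrr psi_0.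
Qed.

(** For [h != 0], translating [c] by [u / h] multiplies the sum by [psi u], which can be chosen
    different from 1. *)
Lemma sum_psi h : \sum_c psi (c * h) = (#|F| * (h == 0))%:R.
Proof.
have [->|h_neq0] := eqVneq h 0.
  by rewrite muln1 -sumr_const; apply: eq_bigr => c _; rewrite mulr0 psi_0.
rewrite muln0; have [u psiu] := psi_nontriv.
apply/eqP; have : (psi u - 1) * (\sum_c psi (c * h)) = 0.
  rewrite mulrBl mul1r big_distrr /=.
  rewrite [X in _ - X](reindex_inj (addrI (u / h))) /=.
  by under [X in _ - X]eq_bigr do rewrite mulrDl divfK // psiD; rewrite subrr.
by move/eqP; rewrite mulf_eq0 subr_eq0 (negPf psiu).
Qed.

Lemma second_moment (T : finType) (A : {set T}) (f : T -> F) :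
  \sum_c `|\sum_(z in A) psi (c * f z)| ^+ 2 =
  (#|F| * \sum_(z in A) #|[set w in A | f w == f z]|)%:R.
Proof.
transitivity (\sum_c \sum_(w in A) \sum_(z in A) psi (c * (f w - f z))).
  apply: eq_bigr => c _; rewrite normCK rmorph_sum mulr_suml.
  apply: eq_bigr => w _; rewrite mulr_sumr; apply: eq_bigr => z _.
  by rewrite /= psi_conj -psiD mulrBr.
rewrite exchange_big big_distrr natr_sum /=; apply: eq_bigr => w _.
rewrite exchange_big /= -sum1dep_card big_distrr natr_sum big_mkcondr /=.
apply: eq_bigr => z _; rewrite sum_psi subr_eq0 eq_sym.
by case: eqP; rewrite ?muln1 ?muln0.
Qed.

(** Bezout gives [u * x = v * n + d], and [z ^ n = 1], so every solution is a root of
    [X ^ d - y ^ u]. *)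
Lemma card_expr_eq (G : {set {unit F}}) x y : (0 < x)%N ->
  (#|[set z in G | val z ^+ x == y]| <= gcdn x #|F|.-1)%N.
Proof.
move=> x_gt0; set n := #|F|.-1; set d := gcdn x n.
have d_gt0 : (0 < d)%N by rewrite gcdn_gt0 x_gt0.
have [u v def_d _] := egcdnP n x_gt0.
have zn (z : {unit F}) : val z ^+ n = 1.
  by rewrite -FinRing.val_unitX /n -card_finField_unit expg_cardG ?inE.
rewrite -ltnS -(size_XnsubC (y ^+ u) d_gt0) cardE -(size_map val).
apply: max_poly_roots; first by rewrite -size_poly_eq0 size_XnsubC.
  apply/allP => _ /mapP[z + ->]; rewrite mem_enum inE => /andP[_ /eqP <-].
  rewrite rootE !hornerE -exprM mulnC def_d exprD mulnC exprM zn.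
  by rewrite expr1n mul1r subrr.
by rewrite map_inj_uniq ?enum_uniq //; apply: val_inj.
Qed.

Lemma subgroup_sum_le (G : {group {unit F}}) x b : (0 < x)%N -> b != 0 ->
  `|\sum_(z in G) psi (b * val z ^+ x)| ^+ 2 <= (gcdn x #|F|.-1 ^ 2 * #|F|)%:R.
Proof.
move=> x_gt0 b_neq0; set d := gcdn x _.
pose U c := \sum_(z in G) psi (c * val z ^+ x).
have UM c w : w \in G -> U (c * val w ^+ x) = U c.
  move=> Gw; rewrite /U [RHS](reindex_inj (mulgI w)) /=.
  by apply: eq_big => z; rewrite ?groupMl // -mulrA -exprMn_comm //; apply: mulrC.
have : #|G|%:R * `|U b| ^+ 2 <= d%:R * \sum_c `|U c| ^+ 2.
  have -> : #|G|%:R * `|U b| ^+ 2 = \sum_(w in G) `|U (b * val w ^+ x)| ^+ 2.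
    rewrite -sum1_card natr_sum mulr_suml.
    by apply: eq_bigr => w /UM ->; rewrite mul1r.
  (* Sort the [w] in [G] by the value [c = b * w ^ x]: by [card_expr_eq], at most [d] of them share
     one value. *)
  rewrite (partition_big (fun w : {unit F} => b * val w ^+ x) xpredT) //=.
  rewrite mulr_sumr; apply: ler_sum => c _.
  under eq_bigr => w /andP[_ /eqP ->] do over.
  rewrite sumr_const -[leLHS]mulr_natl ler_wpM2r ?exprn_ge0 // ler_nat.
  apply: leq_trans (card_expr_eq G x (c / b) x_gt0); apply: subset_leq_card.
  apply/fintype.subsetP => w; rewrite !inE => /andP[-> /eqP <-].
  by rewrite [b * _]mulrC mulfK //=.
rewrite (second_moment _ G (fun z => val z ^+ x)) -natrM => leU.
(* The second moment is at most [#|F| * #|G| * d], so [#|G|] cancels and [d ^ 2 * #|F|] remains. *)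
have G_gt0 : 0 < #|G|%:R :> C by rewrite ltr0n cardG_gt0.
rewrite -(ler_pM2l G_gt0); apply: le_trans leU _.
rewrite -natrM ler_nat.
have : (\sum_(z in G) #|[set w in G | val w ^+ x == val z ^+ x]| <= #|G| * d)%N.
  rewrite -sum_nat_const leq_sum // => z _; exact: card_expr_eq.
move=> /(leq_mul (leqnn (d * #|F|))); rewrite -mulnA => leS.
by apply: leq_trans leS _; rewrite leq_eqVlt; apply/orP; left; apply/eqP; ring.
Qed.

(** * Inclusion-exclusion and primitive roots *)

Section Avoid.
Variables (gT : finGroupType) (f : gT -> C) (B : C).
Hypothesis sum_le : forall G : {group gT}, `|\sum_(z in G) f z| <= B.

(** Avoiding one more [H] subtracts the sum over [G :&: H] from the sum over [G], which doubles the
    bound. The induction needs all [G] at once because [G :&: H] is again a subgroup. *)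
Lemma sum_avoiding_le (Hs : seq {group gT}) (G : {group gT}) :
  `|\sum_(z in G | all (fun H : {group gT} => z \notin H) Hs) f z| <=
    2 ^+ size Hs * B.
Proof.
elim: Hs G => [|H Hs IHs] G /=.
  by rewrite mul1r; under eq_bigl do rewrite andbT; apply: sum_le.
pose P (z : gT) := all (fun H : {group gT} => z \notin H) Hs.
have -> : \sum_(z in G | (z \notin H) && P z) f z =
    \sum_(z in G | P z) f z - \sum_(z in (G :&: H)%G | P z) f z.
  have E : \sum_(z | (z \in G) && P z && (z \in H)) f z =
           \sum_(z in (G :&: H)%G | P z) f z.
    by apply: eq_bigl => z; rewrite finset.in_setI andbAC.
  rewrite [X in _ = X - _](bigID (fun z => z \in H)) /= E [RHS]addrC addKr.
  by apply: eq_bigl => z; rewrite -andbA [_ && P z]andbC.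
rewrite exprS -mulrA mulr_natl mulr2n.
by apply: le_trans (ler_normB _ _) (lerD _ _); apply: IHs.
Qed.
End Avoid.

(** If the order [m] of [z] is a proper divisor of [n], any prime [q] dividing [n %/ m] gives
    [m %| n %/ q], hence [z ^ (n %/ q) = 1]. *)
Lemma primitive_root_primesE (L : fieldType) n (z : L) :
  (0 < n)%N -> z ^+ n = 1 ->
  n.-primitive_root z = all (fun q => z ^+ (n %/ q) != 1) (primes n).
Proof.
move=> n_gt0 zn; apply/idP/allP => [z_prim q|avoid].
  rewrite mem_primes => /and3P[/prime_gt1 q_gt1 _ qn].
  rewrite -(prim_order_dvd z_prim); apply/negP => /dvdn_leq.
  rewrite (divn_gt0 _ (ltnW q_gt1)) (dvdn_leq n_gt0 qn) => /(_ isT).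
  by rewrite leqNgt ltn_Pdiv.
have [m z_prim mn] := prim_order_exists n_gt0 zn.
have [->//|nm_neq1] := eqVneq n m.
have nm_gt1 : (1 < n %/ m)%N.
  rewrite ltn_neqAle divn_gt0 ?(prim_order_gt0 z_prim) // (dvdn_leq n_gt0 mn).
  rewrite andbT eq_sym; apply: contraNneq nm_neq1 => nm1.
  by rewrite -(divnK mn) nm1 mul1n.
have q_n : pdiv (n %/ m) \in primes n.
  rewrite mem_primes pdiv_prime // n_gt0 (dvdn_trans (pdiv_dvd _)) //.
  by rewrite dvdn_div.
case/negP: (avoid _ q_n); rewrite -(prim_order_dvd z_prim).
move: q_n; rewrite mem_primes => /and3P[_ _ qn].
by rewrite dvdn_divRL // mulnC -dvdn_divRL // pdiv_dvd.
Qed.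

Lemma unit_group_abelian : abelian [set: {unit F}].
Proof. by apply/centsP => u _ v _; apply: val_inj; rewrite /= mulrC. Qed.

Lemma big_primitive_root (f : F -> C) :
  \sum_(c | #|F|.-1.-primitive_root c) f c =
  \sum_(z : {unit F} | #|F|.-1.-primitive_root (val z)) f (val z).
Proof.
(* The default [1%g] is reached only from 0, which is never a primitive root. *)
rewrite (reindex_onto (fun z : {unit F} => val z) (insubd (1%g : {unit F}))) /=.
  by apply: eq_bigl => z; rewrite valKd eqxx andbT.
move=> c c_prim; rewrite insubdK // unitfE; apply: contraTneq c_prim => ->.
apply/negP => p0; have := prim_expr_order p0.
by rewrite expr0n gtn_eqF ?(prim_order_gt0 p0) // => /eqP; rewrite eq_sym oner_eq0.
Qed.

Lemma primitive_root_sum_le x b : (0 < x)%N -> b != 0 ->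
  `|\sum_(c | #|F|.-1.-primitive_root c) psi (b * c ^+ x)| <=
    2 ^+ size (primes #|F|.-1) * ((gcdn x #|F|.-1)%:R * sqrtC #|F|%:R).
Proof.
move=> x_gt0 b_neq0; set n := #|F|.-1; rewrite big_primitive_root -/n.
have n_gt0 : (0 < n)%N by rewrite /n -card_finField_unit cardG_gt0.
(* The solutions of [z ^ (n %/ q) = 1] form a subgroup because the unit group is abelian. *)
pose H q := Group (group_Ldiv (n %/ q) unit_group_abelian).
rewrite -(size_map H) (eq_bigl (fun z => (z \in [set: {unit F}]) && 
   all (fun K : {group {unit F}} => z \notin K) (map H (primes n)))) => [|z].
  apply: sum_avoiding_le => G.
  rewrite -ler_sqr ?nnegrE ?normr_ge0 ?mulr_ge0 ?sqrtC_ge0 //.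
  by rewrite exprMn sqrtCK -natrX -natrM subgroup_sum_le.
rewrite inE /= all_map primitive_root_primesE //; last first.
  by rewrite -FinRing.val_unitX /n -card_finField_unit expg_cardG ?inE.
by apply: eq_all => q /=; rewrite !inE -val_eqE /= FinRing.val_unitX.
Qed.

Lemma primitive_root_avg_le (N : nat) b (w : nat -> C) :
  b != 0 -> (forall x, `|w x| = 1) -> (N <= #|F|.-1)%N ->
  `|(totient #|F|.-1)%:R^-1 * \sum_(c | #|F|.-1.-primitive_root c)
     \sum_(1 <= x < N.+1) w x * psi (b * c ^+ x)|
    <= (size (divisors #|F|.-1) ^ 3)%:R * sqrtC #|F|%:R.
Proof.
set n := #|F|.-1; set tau := size (divisors n) => b_neq0 norm_w N_le.
have n_gt0 : (0 < n)%N by rewrite /n -card_finField_unit cardG_gt0.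
have phi_gt0 : 0 < (totient n)%:R :> C by rewrite ltr0n totient_gt0.
have sqrtq_ge0 : 0 <= sqrtC #|F|%:R :> C by rewrite sqrtC_ge0.
rewrite normrM normfV (ger0_norm (ltW phi_gt0)) mulrC ler_pdivrMr // exchange_big /=.
apply: le_trans (ler_norm_sum _ _ _) _.
apply: le_trans (_ : \sum_(1 <= x < N.+1)
    2 ^+ size (primes n) * sqrtC #|F|%:R * (gcdn x n)%:R <= _).
  rewrite big_nat_cond [leRHS]big_nat_cond.
  apply: ler_sum => x /andP[/andP[x_gt0 _] _].
  rewrite -mulr_sumr normrM norm_w mul1r.
  apply: le_trans (primitive_root_sum_le _ _ x_gt0 b_neq0) _.
  by rewrite -/n -mulrA [sqrtC _ * _]mulrC.
rewrite -mulr_sumr -natr_sum.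
rewrite mulrAC -[leRHS]mulrAC -natrX -!natrM ler_wpM2r // ler_nat.
apply: leq_trans (_ : 2 ^ size (primes n) *
    (2 ^ size (primes n) * totient n * tau) <= _)%N.
  rewrite leq_mul2l; apply/orP; right.
  apply: leq_trans (_ : n * tau <= _)%N; last first.
    by rewrite leq_mul2r leq_totient ?orbT.
  apply: leq_trans (sum_gcdn n).
  by rewrite (big_cat_nat (n := N.+1) (p := n.+1)) //= leq_addr.
(* Of the three factors [tau], one comes from the gcd sum. The other two bound the powers of 2 from
   inclusion-exclusion and from [leq_totient]. *)
have := leq_mul (exp2_size_primes n n_gt0) (exp2_size_primes n n_gt0).
by move=> /(leq_mul (leqnn (totient n * tau))); rewrite -/tau; nia.
Qed.

End AdditiveCharacter.

(** * The exponential [e_] as an additive character of ['F_p] *)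

Local Open Scope complex_scope.

Lemma e_cos_sin (R : realType) p alpha (t := 2 * pi * alpha%:~R / p%:R : R) :
  e_ R p alpha = cos t +i* sin t.
Proof.
rewrite /e_ (_ : _ / _ = 0 +i* t) /cexp /= ?expR0 ?mul1r //.
rewrite -complexiE -(rmorph_int (real_complex R)) -(rmorph_nat (real_complex R)).
rewrite -fmorphV /t /=; simpc.
by [].
Qed.

Lemma e_add (R : realType) p alpha beta :
  e_ R p (alpha + beta) = e_ R p alpha * e_ R p beta.
Proof.
rewrite !e_cos_sin rmorphD /= mulrDr mulrDl cosD sinD; simpc.
by congr (_ +i* _); rewrite addrC [X in X + _]mulrC.
Qed.

Lemma norm_e_ (R : realType) p alpha : `|e_ R p alpha| = 1.
Proof. by rewrite e_cos_sin normc_def /= cos2Dsin2 sqrtr1. Qed.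

Lemma e_modulus (R : realType) p : (0 < p)%N -> e_ R p p%:Z = 1.
Proof.
move=> p_gt0; rewrite e_cos_sin mulfK ?pnatr_eq0 -?lt0n // mulr_natl.
by rewrite cos2pi sin2pi.
Qed.

Lemma e_modulusM (R : realType) p k : (0 < p)%N -> e_ R p (p%:Z * k) = 1.
Proof.
move=> p_gt0.
have e_n (n : nat) : e_ R p (p%:Z * n%:Z) = 1.
  elim: n => [|n IHn]; last by rewrite intS mulrDr mulr1 e_add e_modulus // IHn mulr1.
  by rewrite e_cos_sin !mulr0 mul0r cos0 sin0.
case: k => n; first exact: e_n.
by have := e_add R p (p%:Z * Negz n) (p%:Z * n.+1);
  rewrite e_n mulr1 NegzE mulrN addNr -[0](mulr0 p%:Z) (e_n 0%N).
Qed.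

(** For [p = 2] the cosine is -1; for [p > 2] the angle lies strictly between 0 and [pi], so the
    sine is positive. *)
Lemma e_1_neq1 (R : realType) p : (1 < p)%N -> e_ R p 1 != 1.
Proof.
move=> p_gt1; apply/eqP; rewrite e_cos_sin mulr1 => -[].
have p_gt0 : 0 < p%:R :> R by rewrite ltr0n ltnW.
have pi_gt0 : 0 < pi :> R := pi_gt0 R.
have [->|p_neq2] := eqVneq p 2%N.
  by rewrite mulrAC divff ?pnatr_eq0 // mul1r cospi; lra.
have p_gt2 : 2 < p%:R :> R by rewrite ltr_nat ltn_neqAle eq_sym p_neq2.
move=> _ /eqP; rewrite gt_eqF // sin_gt0_pi // divr_gt0 ?mulr_gt0 //=.
by rewrite ltr_pdivrMr // mulrC ltr_pM2l.
Qed.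

Lemma e_Fp (R : realType) p alpha : prime p ->
  e_ R p alpha = e_ R p ((alpha%:~R : 'F_p) : nat)%:Z.
Proof.
move=> p_pr; set r : nat := (_ : 'F_p).
have /dvdzP[k kE] : (p%:Z %| alpha - r%:Z)%Z.
  by rewrite (dvdz_pcharf (pchar_Fp p_pr)) rmorphB /= -pmulrn natr_Zp subrr.
by rewrite -[alpha](subrK r%:Z) kE mulrC e_add e_modulusM ?prime_gt0 // mul1r.
Qed.

(** * Specialisation to ['F_p] and the final exponent *)

Theorem theorem1 (R : realType) (eps : R) (heps : 0 < eps) :
  exists C : R, 0 < C /\
    forall (p N r : nat) (a b : int) (bs gs : 'I_r -> int),
      prime p ->
      (1 <= N <= p.-1)%N ->
      (0 < r)%N ->
      ~ [/\ (p%:Z %| a)%Z, (p%:Z %| b)%Z & forall i, (p%:Z %| bs i)%Z] ->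
      coprimez b p%:Z ->
      (forall i, primitive_root_mod p (gs i)) ->
      `| primitive_root_avg p (fun g : int =>
           \sum_(1 <= x < N.+1)
              e_ R p (a * x%:Z + b * g ^+ x + \sum_(i < r) bs i * gs i ^+ x)) |
        <= (C * p%:R `^ (23 / 24 + eps))%:C.
Proof.
(* The exponent 12 = 3 * 4 is chosen so that the cube of the divisor count is at most a constant
   times [p ^ (1/4)]. *)
have [M [M_gt0 tauM]] : exists M : nat, (0 < M)%N /\
    forall n, (0 < n)%N -> (size (divisors n) ^ 12 <= M * n)%N.
  exists ((12 ^ 12) ^ (2 ^ 12))%N; split; first by rewrite !expn_gt0.
  by move=> n; apply: size_divisors_exp.
exists M%:R; split; first by rewrite ltr0n.
move=> p N r a b bs gs p_pr /andP[_ N_le] _ _ cop _.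
have p_gt1 := prime_gt1 p_pr; have p_gt0 := prime_gt0 p_pr.
have n_gt0 : (0 < p.-1)%N by rewrite -ltnS prednK.
pose psi (u : 'F_p) := e_ R p (u : nat)%:Z.
have psiE alpha : psi alpha%:~R = e_ R p alpha by rewrite /psi -e_Fp.
have psiD u v : psi (u + v) = psi u * psi v.
  rewrite -[in LHS](natr_Zp u) -[in LHS](natr_Zp v) -natrD.
  by rewrite (psiE (u + v)%N) PoszD e_add.
have psi_nontriv : exists u, psi u != 1.
  by exists 1; rewrite (psiE 1) e_1_neq1.
have b_neq0 : (b%:~R : 'F_p) != 0.
  rewrite -(dvdz_pcharf (pchar_Fp p_pr)) dvdzE /= -prime_coprime // coprime_sym.
  by move: cop; rewrite coprimezE.
(* [w] gathers the factors of modulus 1 that do not depend on the averaged [g]. *)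
pose w (x : nat) := e_ R p (a * x%:Z + \sum_(i < r) bs i * gs i ^+ x).
pose G c := \sum_(1 <= x < N.+1) w x * psi (b%:~R * c ^+ x).
have := @primitive_root_avg_le _ _ psi psiD (fun u => norm_e_ R p u) psi_nontriv
  N b%:~R w b_neq0 (fun x => norm_e_ _ _ _).
rewrite card_Fp // => /(_ N_le).
have <- : primitive_root_avg p (fun g : int => \sum_(1 <= x < N.+1)
      e_ R p (a * x%:Z + b * g ^+ x + \sum_(i < r) bs i * gs i ^+ x)) =
    (totient p.-1)%:R^-1 * \sum_(c | p.-1.-primitive_root c) G c.
  rewrite /primitive_root_avg; congr (_ * _).
  (* A range of naturals mediates between the index types ['I_p] and ['F_p], whose bounds agree only
     through [Fp_cast]. *)
  transitivity (\sum_(0 <= g < p | p.-1.-primitive_root (g%:R : 'F_p)) G g%:R).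
    rewrite big_mkord; apply: eq_bigr => g _; apply: eq_bigr => x _.
    rewrite addrAC e_add -/(w x) -[e_ R p (b * _)]psiE.
    by rewrite rmorphM rmorphXn /= -pmulrn.
  rewrite -[X in index_iota 0 X](Fp_cast p_pr) big_mkord.
  by apply: eq_big => c; rewrite ?natr_Zp.
move/le_trans; apply.
set P : R := p%:R.
have P_ge1 : 1 <= P by rewrite ler1n.
have P_ge0 : 0 <= P := le_trans ler01 P_ge1.
have P_neq0 : P != 0 by rewrite pnatr_eq0 -lt0n.
have -> : sqrtC p%:R = (P `^ 2^-1)%:C :> R[i].
  rewrite -(rmorph_nat (real_complex R)) powR12_sqrt // -/P -[in LHS](sqr_sqrtr P_ge0).
  by rewrite rmorphXn /= sqrCK // lecR sqrtr_ge0.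
rewrite -(rmorph_nat (real_complex R)) -rmorphM lecR.
have root4 : (P `^ 4^-1) ^+ 4 = P.
  by rewrite -powR_mulrn ?powR_ge0 // -powRrM mulVf ?powRr1 // pnatr_eq0.
have le_root : (size (divisors p.-1) ^ 3)%:R <= M%:R * P `^ 4^-1.
  rewrite -(@ler_pXn2r _ 4) ?nnegrE ?mulr_ge0 ?powR_ge0 ?ler0n //.
  rewrite exprMn root4 -!natrX -natrM ler_nat -expnM.
  apply: leq_trans (tauM _ n_gt0) _; apply: leq_mul; last exact: leq_pred.
  by rewrite -[leqLHS]expn1 leq_pexp2l.
apply: le_trans (ler_wpM2r (powR_ge0 _ _) le_root) _.
(* The exponents add up to 1/4 + 1/2 = 3/4, below 23/24, and [P >= 1]. *)
rewrite -mulrA ler_wpM2l ?ler0n // -powRD ?P_neq0 ?implybT //.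
by apply: ler_powR => //; lra.
Qed.
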